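(* Let $G$ be a graph of order $n$ with maximum degree $\Delta(G)=2$. Then $\mathcal{A}(G)\ge \mathcal{A}\big(K_{1,2}\cup(n-3)K_1\big)$, with equality if and only if $G\simeq K_{1,2}\cup (n-3)K_1$.
   Context: All graphs are finite, simple and undirected. A coloring of a graph $G$ assigns colors to its vertices so that adjacent vertices receive different colors; two colorings are equivalent if they induce the same partition of the vertex set into color classes. $S(G,k)$ denotes the number of non-equivalent colorings of $G$ using exactly $k$ colors. Set $\mathcal{B}(G)=\sum_{k\ge1}S(G,k)$, $\mathcal{T}(G)=\sum_{k\ge1}kS(G,k)$ and $\mathcal{A}(G)=\mathcal{T}(G)/\mathcal{B}(G)$. $K_{1,2}$ is the star with two leaves (path on 3 vertices), $\cup$ disjoint union, and $pK_1$ denotes $p$ isolated vertices. *)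

(* Defs.v *)
From mathcomp Require Import all_boot all_order all_algebra.

Set Implicit Arguments.
Unset Strict Implicit.
Unset Printing Implicit Defensive.

Import GRing.Theory Num.Theory.

Record sgraph := SGraph {
  vertex :> finType;
  adj : rel vertex;
  adj_sym : symmetric adj;
  adj_irrefl : irreflexive adj }.

Definition degree (G : sgraph) (x : G) : nat := #|[set y | adj x y]|.

Definition max_degree (G : sgraph) : nat := \max_(x : G) degree x.

Definition isomorphic (G H : sgraph) : Prop :=
  exists2 f : G -> H, bijective f & forall x y, adj (f x) (f y) = adj x y.

Definition is_coloring (G : sgraph) (k : nat) (f : {ffun G -> 'I_k}) : bool :=
  [forall x, forall y, adj x y ==> (f x != f y)].

Definition uses_all_colors (G : sgraph) (k : nat) (f : {ffun G -> 'I_k}) :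
    bool :=
  [forall c, exists x, f x == c].

(* Equivalent colorings are those with the same partition into color classes,
   so the classes of colorings are counted through the partitions induced. *)
Definition colS (G : sgraph) (k : nat) : nat :=
  #|[set preim_partition f [set: G] |
       f : {ffun G -> 'I_k} & is_coloring f && uses_all_colors f]|.

(* colS G k = 0 for k > #|G|, so the sums over k >= 1 stop at #|G|. *)
Definition colB (G : sgraph) : nat := \sum_(1 <= k < #|G|.+1) colS G k.

Definition colT (G : sgraph) : nat := \sum_(1 <= k < #|G|.+1) k * colS G k.

Definition colA (G : sgraph) : rat := ((colT G)%:R / (colB G)%:R)%R.

Section EdgelessGraph.
Variable p : nat.
Definition edgeless_adj : rel 'I_p := fun _ _ => false.
Fact edgeless_sym : symmetric edgeless_adj. Proof. by []. Qed.
Fact edgeless_irrefl : irreflexive edgeless_adj. Proof. by []. Qed.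
Definition edgeless : sgraph := SGraph edgeless_sym edgeless_irrefl.
End EdgelessGraph.

Section CompleteBipartite.
Variables m n : nat.
Definition biclique_adj : rel ('I_m + 'I_n)%type := fun u v =>
  match u, v with
  | inl _, inr _ | inr _, inl _ => true
  | _, _ => false
  end.
Fact biclique_sym : symmetric biclique_adj. Proof. by move=> [?|?] [?|?]. Qed.
Fact biclique_irrefl : irreflexive biclique_adj. Proof. by case. Qed.
Definition biclique : sgraph := SGraph biclique_sym biclique_irrefl.
End CompleteBipartite.

Section DisjointUnion.
Variables G H : sgraph.
Definition gunion_adj : rel (G + H)%type := fun u v =>
  match u, v with
  | inl x, inl y => adj x y
  | inr x, inr y => adj x y
  | _, _ => false
  end.
Fact gunion_sym : symmetric gunion_adj.
Proof. by move=> [x|x] [y|y] //=; rewrite adj_sym. Qed.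
Fact gunion_irrefl : irreflexive gunion_adj.
Proof. by move=> [x|x] /=; rewrite adj_irrefl. Qed.
Definition gunion : sgraph := SGraph gunion_sym gunion_irrefl.
End DisjointUnion.

(* Main.v *)
Require Import Defs.
From mathcomp Require Import all_boot all_order all_algebra.
From mathcomp Require Import all_fingroup zify ring lra.

(* Write p_G(j) for the number of proper j-colorings of G and let X be the number
   of fixed points of a uniform random permutation of n + 1 letters, whose
   factorial moments of order at most n + 1 are all 1. Since p_G is the sum of
   the S(G,k) X(X-1)...(X-k+1), B(G) = E[p_G(X)] and T(G) + B(G) = E[X p_G(X)].
   So A(G) + 1 is the mean of X under the law weighted by p_G, and Chebyshev's
   sum inequality gives A(H) <= A(G) as soon as p_G / p_H is nondecreasing where p_H > 0.

   Peeling off isolated vertices, leaves and cycles writes p_G(j) / j^n as a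
   product of factors phi = (j-1)/j, one per leaf, and psi_k, one per cycle of
   length k + 1, while p_H(j) / j^n = phi^2 for H the path on three vertices plus
   isolated ones. The claim reduces to the monotonicity of phi and of
   psi_k / phi^2, and the quotient is constant only if G has two edges. *)

Set Implicit Arguments.
Unset Strict Implicit.
Unset Printing Implicit Defensive.

Import Order.TTheory GRing.Theory Num.Theory.

(** * Counting partitions through random permutations *)

Definition ncolorings (G : sgraph) (j : nat) : nat :=
  #|[set f : {ffun G -> 'I_j} | is_coloring f]|.

Definition colS_set (G : sgraph) (k : nat) : {set {set {set G}}} :=
  [set preim_partition f [set: G] |
       f : {ffun G -> 'I_k} & is_coloring f && uses_all_colors f].

Lemma is_coloringP (G : sgraph) k (f : {ffun G -> 'I_k}) :
  reflect (forall x y, adj x y -> f x != f y) (is_coloring f).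
Proof.
apply: (iffP forallP) => [h x y|h x].
  by move/forallP: (h x) => /(_ y) /implyP.
by apply/forallP => y; apply/implyP; apply: h.
Qed.

Lemma preim_partition_eqP (T : finType) (A B : eqType) (f : T -> A) (g : T -> B) :
  reflect (forall x y, (f x == f y) = (g x == g y))
    (preim_partition f [set: T] == preim_partition g [set: T]).
Proof.
apply: (iffP eqP) => [efg x y|efg].
  have pb (C : eqType) (h : T -> C) u v :
      (v \in pblock (preim_partition h [set: T]) u) = (h u == h v).
    rewrite pblock_equivalence_partition ?inE // => a b c _ _ _; split=> //.
    by move/eqP->.
  by rewrite -!pb efg.
by apply: eq_imset => x; apply/setP => y; rewrite !inE efg.
Qed.

(** The colorings inducing the partition of a surjective [g] are the compositions [h \o g] with [h]
    an injection of colors, and the composite determines [h]. *)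
Lemma card_preim_partition_fiber (T : finType) (j k : nat)
    (g : {ffun T -> 'I_k}) :
  (forall c, exists x, g x = c) ->
  #|[set f : {ffun T -> 'I_j} |
      preim_partition f [set: T] == preim_partition g [set: T]]| = j ^_ k.
Proof.
move=> gsurj.
have [w gw] : exists w : 'I_k -> T, forall c, g (w c) = c.
  have h c : {x | g x = c}.
    case: (pickP (fun x => g x == c)) => [x /eqP|n]; first by exists x.
    by exfalso; case: (gsurj c) => x /eqP; rewrite n.
  by exists (fun c => sval (h c)) => c; case: (h c).
have := card_inj_ffuns 'I_k 'I_j; rewrite !card_ord => <-.
pose comp (h : {ffun 'I_k -> 'I_j}) : {ffun T -> 'I_j} := [ffun x => h (g x)].
have <- : comp @: [set h : {ffun 'I_k -> 'I_j} | injectiveb h]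
   = [set f : {ffun T -> 'I_j} |
      preim_partition f [set: T] == preim_partition g [set: T]].
  apply/setP => f; apply/imsetP/idP.
    case=> h; rewrite inE => /injectiveP hinj ->; rewrite inE.
    by apply/preim_partition_eqP => x y; rewrite !ffunE (inj_eq hinj).
  rewrite inE => /preim_partition_eqP fg.
  exists [ffun c => f (w c)].
    rewrite inE; apply/injectiveP => c d; rewrite !ffunE => /eqP.
    by rewrite fg !gw => /eqP.
  by apply/ffunP => x; rewrite !ffunE; apply/eqP; rewrite fg gw.
apply: card_imset => h h' /ffunP e; apply/ffunP => c.
by have := e (w c); rewrite !ffunE gw.
Qed.

Lemma uses_all_colorsP (G : sgraph) k (f : {ffun G -> 'I_k}) :
  reflect (forall c, exists x, f x = c) (uses_all_colors f).
Proof.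
apply: (iffP forallP) => h c; first by case/existsP: (h c) => x /eqP; exists x.
by case: (h c) => x /eqP e; apply/existsP; exists x.
Qed.

(** The [l]-colorings inducing [Q] number both [l ^_ k] and [l ^_ l], and the latter is positive. By
    symmetry a partition determines its number of classes. *)
Lemma colS_set_uniq (G : sgraph) k l (Q : {set {set G}}) :
  Q \in colS_set G k -> Q \in colS_set G l -> k <= l.
Proof.
case/imsetP=> f /=; rewrite inE => /andP[_ /uses_all_colorsP fs] ->.
case/imsetP=> g /=; rewrite inE => /andP[_ /uses_all_colorsP gs] /eqP fg.
have := card_preim_partition_fiber l fs.
have := card_preim_partition_fiber l gs; rewrite ffactnn (eqP fg) => -> e.
by rewrite leqNgt; apply/negP => /ffact_small e0; move: (fact_gt0 l); rewrite e e0.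
Qed.

Lemma coloring_colS_set (G : sgraph) j (f : {ffun G -> 'I_j}) :
  is_coloring f -> preim_partition f [set: G] \in colS_set G #|f @: [set: G]|.
Proof.
move=> /is_coloringP fc.
have fin x : f x \in f @: [set: G] by apply: imset_f.
pose g : {ffun G -> 'I_#|f @: [set: G]|} :=
  [ffun x => enum_rank_in (fin x) (f x)].
have gf x : enum_val (g x) = f x by rewrite ffunE enum_rankK_in.
have fg x y : (f x == f y) = (g x == g y) by rewrite -!gf (inj_eq enum_val_inj).
apply/imsetP; exists g; last by apply/eqP/preim_partition_eqP.
rewrite inE; apply/andP; split.
  by apply/is_coloringP => x y /fc; rewrite fg.
apply/uses_all_colorsP => c; have /imsetP[x _ e] := enum_valP c.
by exists x; apply: enum_val_inj; rewrite gf.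
Qed.

(** Colorings are grouped by the partition they induce: this is the expansion of the chromatic
    polynomial in falling factorials. *)
Lemma ncolorings_ffact (G : sgraph) j :
  ncolorings G j = \sum_(k < #|G|.+1) colS G k * j ^_ k.
Proof.
pose p (f : {ffun G -> 'I_j}) := preim_partition f [set: G].
rewrite /ncolorings -sum1dep_card.
transitivity (\sum_(f : {ffun G -> 'I_j} | is_coloring f)
                 \sum_(k < #|G|.+1) (p f \in colS_set G k)).
  apply: eq_bigr => f fc; have fS := coloring_colS_set fc.
  have kn : #|f @: [set: G]| < #|G|.+1.
    by rewrite ltnS (leq_trans (leq_imset_card _ _)) // max_card.
  rewrite (bigD1 (Ordinal kn)) //= -/(p f) fS big1 // => l nl.
  case: (boolP (_ \in _)) => // lS; case/eqP: nl; apply: val_inj => /=.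
  by apply/eqP; rewrite eqn_leq !(@colS_set_uniq _ _ _ (p f)).
rewrite exchange_big; apply: eq_bigr => k _ /=.
transitivity (\sum_(f : {ffun G -> 'I_j} | is_coloring f)
    \sum_(Q in colS_set G k) (p f == Q)).
  apply: eq_bigr => f _; case: (boolP (_ \in _)) => [pS|pS].
    by rewrite (bigD1 (p f)) //= eqxx big1 // => Q /andP[_]; rewrite eq_sym => /negbTE->.
  by rewrite big1 // => Q QS; case: eqP => // e; rewrite e QS in pS.
rewrite exchange_big /= -[colS G k]/#|colS_set G k| -sum_nat_const.
apply: eq_bigr => Q /imsetP[g]; rewrite inE => /andP[gc /uses_all_colorsP gs] ->.
rewrite -(card_preim_partition_fiber j gs) -sum1dep_card big_mkcond [RHS]big_mkcond.
apply: eq_bigr => f _ /=; case: ifP => // fc; case: preim_partition_eqP => // e.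
case/negP: fc; apply/is_coloringP => x y; rewrite e.
by move/is_coloringP: gc; apply.
Qed.

Definition nfix (N : nat) (s : 'S_N) : nat := #|[set i | s i == i]|.

(* The fixed points of a uniform random permutation of N letters have the same
   factorial moments, all equal to 1, as a Poisson variable, up to order N. *)
Lemma sum_ffact_nfix (N k : nat) :
  k <= N -> \sum_(s : 'S_N) nfix s ^_ k = N`!.
Proof.
move=> kN.
(* [nfix s ^_ k] counts the injective [k]-tuples of fixed points of [s]. *)
transitivity (\sum_(s : 'S_N) \sum_(f : {ffun 'I_k -> 'I_N} | injectiveb f)
     [forall i, s (f i) == f i]).
  apply: eq_bigr => s _.
  have := card_inj_ffuns_on 'I_k (mem [set i | s i == i]).
  rewrite card_ord /nfix => <-; rewrite -sum1dep_card big_mkcond [RHS]big_mkcond.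
  apply: eq_bigr => f _ /=; rewrite andbC; case: (injectiveb f) => //=.
  case: ffun_onP => h; case: forallP => //= h'.
    by case: h' => i; move: (h i); rewrite inE.
  by case: h => i; rewrite unfold_in inE h'.
rewrite exchange_big /= -(ffact_fact kN).
have := card_inj_ffuns 'I_k 'I_N; rewrite !card_ord => <-.
rewrite -sum_nat_cond_const /=; apply: eq_bigr => f /injectiveP finj.
(* A permutation fixing the image of [f] pointwise is one supported on the complement, which leaves
   [(N - k)!] choices per injection. *)
rewrite -[N - k](_ : #|~: [set f i | i : 'I_k]| = _); last first.
  by rewrite cardsCs setCK card_imset // !card_ord.
rewrite -card_perm -sum1_card [RHS]big_mkcond; apply: eq_bigr => s _.
rewrite -[s \in perm_on _]/(perm_on _ s) /perm_on.
case: forallP => h; case: subsetP => //= h'.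
  case: h' => x; rewrite !inE => sx; apply/negP => /imsetP[i _ e].
  by rewrite e h in sx.
case: h => i; apply/negPn/negP => ni; move: (h' (f i) ni).
by rewrite inE imset_f.
Qed.

Lemma colS0 (G : sgraph) : 0 < #|G| -> colS G 0 = 0.
Proof.
case/card_gt0P=> x _; apply: eq_card0 => Q; apply/negbTE/imsetP => -[f].
by case: (f x).
Qed.

Lemma sum_ncolorings_nfix (G : sgraph) (N : nat) :
  0 < #|G| -> #|G| <= N ->
  \sum_(s : 'S_N) ncolorings G (nfix s) = N`! * colB G.
Proof.
move=> G0 GN.
under eq_bigr do rewrite ncolorings_ffact.
rewrite exchange_big /= /colB big_distrr /=.
rewrite -(big_mkord predT (fun k => \sum_(s : 'S_N) colS G k * nfix s ^_ k)) /=.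
rewrite big_ltn // colS0 // big1 // add0n.
rewrite !big_nat; apply: eq_bigr => k /andP[_ kG].
by rewrite -big_distrr /= sum_ffact_nfix 1?mulnC // (leq_trans _ GN).
Qed.

Lemma mul_ffact j k : j * j ^_ k = j ^_ k.+1 + k * j ^_ k.
Proof.
case: (leqP k j) => kj; last by rewrite !ffact_small ?muln0 // ltnW.
by rewrite ffactnSr mulnC [k * _]mulnC -mulnDr subnK.
Qed.

(** By [mul_ffact], the factor [nfix s] creates falling factorials of order [k + 1], whose averages
    give the extra [colB G]. The order reaches [#|G| + 1], hence the strict bound on [#|G|]. *)
Lemma sum_mul_ncolorings_nfix (G : sgraph) (N : nat) :
  0 < #|G| -> #|G| < N ->
  \sum_(s : 'S_N) nfix s * ncolorings G (nfix s) = N`! * (colT G + colB G).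
Proof.
move=> G0 GN.
under eq_bigr do rewrite ncolorings_ffact big_distrr.
rewrite exchange_big /= /colB /colT -big_split big_distrr /=.
rewrite -(big_mkord predT (fun k => \sum_(s : 'S_N) nfix s * (colS G k * nfix s ^_ k))) /=.
rewrite big_ltn // colS0 // big1 ?add0n => [|s _]; last by rewrite muln0.
rewrite !big_nat; apply: eq_bigr => k /andP[_ kG].
under eq_bigr => s _ do rewrite mulnCA mul_ffact mulnDr.
rewrite big_split /= -!big_distrr /=.
have kN : k < N by apply: leq_trans GN.
rewrite !sum_ffact_nfix ?(ltnW kN) //.
by ring.
Qed.

(** * Peeling a graph of maximum degree two *)

Section Resampling.
Variables (T : finType) (j : nat).
Implicit Type f : {ffun T -> 'I_j}.

Definition recolor f (v : T) (c : 'I_j) : {ffun T -> 'I_j} :=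
  [ffun x => if x == v then c else f x].

Lemma recolor_at f v c : recolor f v c v = c.
Proof. by rewrite ffunE eqxx. Qed.

Lemma recolor_off f v c x : x != v -> recolor f v c x = f x.
Proof. by rewrite ffunE => /negbTE->. Qed.

(* Swapping the color of v with a fresh color c is an involution on the pairs
   (f, c). *)
Lemma card_resample v (P : pred {ffun T -> 'I_j}) (Q : {ffun T -> 'I_j} -> pred 'I_j) :
  (forall f c, P (recolor f v c) = P f) ->
  (forall f c, Q (recolor f v c) =1 Q f) ->
  j * #|[set f | P f && Q f (f v)]| = \sum_(f | P f) #|[set c | Q f c]|.
Proof.
move=> hP hQ.
transitivity (\sum_(u : {ffun T -> 'I_j} * 'I_j) (P u.1 && Q u.1 (u.1 v))).
  rewrite -(pair_bigA _ (fun f (c : 'I_j) => (P f && Q f (f v) : nat))) /=.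
  rewrite -sum1dep_card big_distrr big_mkcond /=.
  apply: eq_bigr => f _; rewrite sum_nat_const card_ord.
  by case: (P f && Q f (f v)); rewrite ?muln1 ?muln0.
pose sw (u : {ffun T -> 'I_j} * 'I_j) := (recolor u.1 v u.2, u.1 v).
have swK : cancel sw sw.
  case=> f c; rewrite /sw /= recolor_at; congr pair.
  by apply/ffunP => x; rewrite !ffunE; case: eqP => // ->.
rewrite (reindex_inj (can_inj swK)) /=.
under eq_bigr => u _ do rewrite hP hQ recolor_at.
rewrite -(pair_bigA _ (fun f (c : 'I_j) => (P f && Q f c : nat))) /=.
rewrite [RHS]big_mkcond; apply: eq_bigr => f _ /=.
rewrite -sum1dep_card [X in if _ then X else _]big_mkcond /=; case: (P f) => //=.
by rewrite big1.
Qed.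

(** Since [P] ignores the color of [v], that color can be redrawn, and [#|f @: S|] of the [j]
    choices are bad. The additive form avoids truncated subtraction. *)
Lemma card_resample_avoid v (S : {set T}) (P : pred {ffun T -> 'I_j}) :
  v \notin S -> (forall f c, P (recolor f v c) = P f) ->
  j * #|[set f : {ffun T -> 'I_j} | P f && (f v \notin f @: S)]|
  + \sum_(f | P f) #|f @: S| = j * #|[set f | P f]|.
Proof.
move=> vS hP.
rewrite (@card_resample v P (fun f c => c \notin f @: S)) //; last first.
  move=> f c d /=; congr (~~ (_ \in pred_of_set _)).
  by apply: eq_in_imset => x xS; rewrite recolor_off //; apply: contraNneq vS => <-.
rewrite -big_split /= mulnC -sum1dep_card big_distrl /=.
apply: eq_bigr => f _; rewrite mul1n -[RHS](card_ord j).
by rewrite -(cardsC (f @: S)) addnC; congr (_ + _); apply: eq_card => c; rewrite !inE.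
Qed.

End Resampling.

(** * Colorings proper on a vertex subset, and the effect of deleting a vertex *)

Section Induced.
Variable G : sgraph.
Implicit Types (A : {set G}) (v x y z : G).

Definition nbrs A v : {set G} := [set y in A | adj v y].
Definition deg_in A v : nat := #|nbrs A v|.
(** Twice the number of edges inside [A]. *)
Definition deg_sum A : nat := \sum_(v in A) deg_in A v.

(** Colorings stay defined on all of [G] and are free outside [A], so deleting a vertex changes [A]
    but no type. *)
Definition proper_on A (j : nat) (f : {ffun G -> 'I_j}) : bool :=
  [forall x in A, [forall y in A, adj x y ==> (f x != f y)]].
Definition nproper A j : nat := #|[set f : {ffun G -> 'I_j} | proper_on A f]|.
(** The condition on [x] and [y] acts as an extra edge between them. *)
Definition nproper_sep A x y j : nat :=
  #|[set f : {ffun G -> 'I_j} | proper_on A f && (f x != f y)]|.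

Lemma proper_onP A j (f : {ffun G -> 'I_j}) :
  reflect {in A &, forall x y, adj x y -> f x != f y} (proper_on A f).
Proof.
apply: (iffP forall_inP) => [h x y xA yA|h x xA].
  by have /forall_inP/(_ y yA)/implyP := h x xA.
by apply/forall_inP => y yA; apply/implyP; apply: h.
Qed.

Lemma proper_on_recolor A v j (f : {ffun G -> 'I_j}) c :
  proper_on (A :\ v) (recolor f v c) = proper_on (A :\ v) f.
Proof.
apply/proper_onP/proper_onP => h x y xA yA xy; move: (h x y xA yA xy);
  by move: xA yA; rewrite !inE => /andP[xv _] /andP[yv _]; rewrite !recolor_off.
Qed.

Lemma proper_onD1 A v j (f : {ffun G -> 'I_j}) : v \in A ->
  proper_on A f = proper_on (A :\ v) f && (f v \notin f @: nbrs A v).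
Proof.
move=> vA; apply/proper_onP/andP => [h|[/proper_onP h /imsetP nv] x y xA yA xy].
  split; first by apply/proper_onP => x y /setD1P[_ xA] /setD1P[_ yA]; apply: h.
  apply/imsetP => -[y]; rewrite inE => /andP[yA vy] e.
  by have := h v y vA yA vy; rewrite e eqxx.
have [xv|xv] := eqVneq x v.
  apply/eqP => e; apply: nv; exists y; last by rewrite -e xv.
  by rewrite inE yA -xv.
have [yv|yv] := eqVneq y v.
  apply/eqP => e; apply: nv; exists x; last by rewrite e yv.
  by rewrite inE xA -yv adj_sym.
by apply: h; rewrite ?inE ?xv ?yv.
Qed.

Lemma notin_nbrs A v : v \notin nbrs A v.
Proof. by rewrite inE adj_irrefl andbF. Qed.

Lemma deg_inD1 A v x : v \in A -> deg_in A x = adj x v + deg_in (A :\ v) x.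
Proof.
move=> vA; rewrite /deg_in (cardsD1 v) inE vA; congr (_ + _).
by apply: eq_card => y; rewrite !inE andbA.
Qed.

Lemma deg_sumD1 A v : v \in A -> deg_sum A = deg_sum (A :\ v) + 2 * deg_in A v.
Proof.
move=> vA; rewrite /deg_sum (big_setD1 v) //=.
under eq_bigr => x _ do rewrite (deg_inD1 _ vA).
rewrite big_split /=; suff -> : \sum_(x in A :\ v) adj x v = deg_in A v by lia.
rewrite /deg_in -sum1_card big_mkcond [RHS]big_mkcond /=.
apply: eq_bigr => x _; rewrite !inE adj_sym; case: eqVneq => [->|_] /=.
  by rewrite adj_irrefl andbF.
by case: (x \in A); case: adj.
Qed.

Lemma imset_pair_card j (f : {ffun G -> 'I_j}) x y :
  #|f @: [set x; y]| = 1 + (f x != f y).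
Proof. by rewrite imsetU1 imset_set1 cards2. Qed.

Lemma nproper0 j : nproper set0 j = j ^ #|G|.
Proof.
rewrite -[j in RHS]card_ord -card_ffun -cardsT; apply: eq_card => f.
by rewrite !inE; apply/proper_onP => x y; rewrite inE.
Qed.

Lemma nproper_deg0 A v j : v \in A -> deg_in A v = 0 ->
  nproper A j = nproper (A :\ v) j.
Proof.
move=> vA /eqP; rewrite cards_eq0 => /eqP n0; apply: eq_card => f.
by rewrite !inE (proper_onD1 _ vA) n0 imset0 inE andbT.
Qed.

Lemma nproper_avoid A v (S : {set G}) j : v \in A -> v \notin S ->
  j * #|[set f : {ffun G -> 'I_j} | proper_on (A :\ v) f && (f v \notin f @: S)]|
  + \sum_(f : {ffun G -> 'I_j} | proper_on (A :\ v) f) #|f @: S|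
  = j * nproper (A :\ v) j.
Proof.
by move=> vA vS; apply: card_resample_avoid => // f c; apply: proper_on_recolor.
Qed.

Lemma nproper_deg1 A v j : v \in A -> deg_in A v = 1 ->
  j * nproper A j + nproper (A :\ v) j = j * nproper (A :\ v) j.
Proof.
move=> vA /eqP/cards1P[u nu].
rewrite -(nproper_avoid _ vA (notin_nbrs A v)); congr (_ * _ + _).
  by apply: eq_card => f; rewrite !inE (proper_onD1 _ vA).
by rewrite nu; under eq_bigr do rewrite imset_set1 cards1; rewrite sum1dep_card.
Qed.

Lemma sum_card_imset_pair A x y j :
  \sum_(f : {ffun G -> 'I_j} | proper_on A f) #|f @: [set x; y]|
  = nproper A j + nproper_sep A x y j.
Proof.
under eq_bigr do rewrite imset_pair_card.
rewrite big_split /= sum1dep_card; congr (_ + _).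
rewrite /nproper_sep -sum1dep_card big_mkcond [RHS]big_mkcond.
by apply: eq_bigr => f _; case: proper_on => //=; case: (_ == _).
Qed.

Lemma nproper_deg2 A v u w j : v \in A -> nbrs A v = [set u; w] ->
  j * nproper A j + (nproper (A :\ v) j + nproper_sep (A :\ v) u w j)
  = j * nproper (A :\ v) j.
Proof.
move=> vA nu.
rewrite -(nproper_avoid _ vA (notin_nbrs A v)) nu sum_card_imset_pair.
congr (_ * _ + _).
by apply: eq_card => f; rewrite !inE (proper_onD1 _ vA) nu.
Qed.

(** The end [y] must avoid the colors of [x] and of its only neighbor [z]; redrawing its color moves
    the separated pair from [x], [y] to [x], [z]. This is the source of the recursion of [psi]. *)
Lemma nproper_sep_deg1 A x y z j : y \in A -> nbrs A y = [set z] -> x != y ->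
  j * nproper_sep A x y j + (nproper (A :\ y) j + nproper_sep (A :\ y) x z j)
  = j * nproper (A :\ y) j.
Proof.
move=> yA nz xy.
have yz : y != z by have := notin_nbrs A y; rewrite nz inE.
have yS : y \notin [set x; z] by rewrite !inE negb_or eq_sym xy.
rewrite -(nproper_avoid _ yA yS) sum_card_imset_pair; congr (_ * _ + _).
apply: eq_card => f; rewrite !inE (proper_onD1 _ yA) nz imset_set1 -andbA.
rewrite imsetU1 imset_set1 !inE negb_or [f x == f y]eq_sym.
by case: (f y == f x); case: (f y == f z).
Qed.

Local Open Scope ring_scope.

Definition phi (j : nat) : rat := 1 - j%:R^-1.
(* [psi k j] is the probability that a random j-coloring of the cycle with
   k + 1 edges is proper. *)
Fixpoint psi (k j : nat) : rat :=
  if k is k'.+1 then phi j ^+ k'.+1 - psi k' j / j%:R else 0.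

(** The normalization is by all colorings of [G], whatever [A] is, so removing an isolated vertex
    from [A] changes nothing. *)
Definition prob A j : rat := (nproper A j)%:R / (j ^ #|G|)%:R.
Definition prob_sep A x y j : rat := (nproper_sep A x y j)%:R / (j ^ #|G|)%:R.

Lemma solve_mul (j a b c : rat) : j != 0 -> j * a + b = j * c -> a = c - b / j.
Proof. by move=> j0 e; rewrite -[c](mulKf j0) -e; field. Qed.

Lemma prob0 j : (0 < j)%N -> prob set0 j = 1.
Proof. by move=> j0; rewrite /prob nproper0 divff // pnatr_eq0 expn_eq0; lia. Qed.

Lemma prob_deg0 A v j : v \in A -> deg_in A v = 0 -> prob A j = prob (A :\ v) j.
Proof. by move=> vA d; rewrite /prob (nproper_deg0 j vA d). Qed.

Lemma prob_deg1 A v j : (0 < j)%N -> v \in A -> deg_in A v = 1 ->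
  prob A j = phi j * prob (A :\ v) j.
Proof.
move=> j0 vA d; have := congr1 (fun m => m%:R : rat) (nproper_deg1 j vA d).
have jn : j%:R != 0 :> rat by rewrite pnatr_eq0; lia.
by rewrite /= natrD !natrM /prob /phi => /(solve_mul jn) ->; ring.
Qed.

Lemma prob_deg2 A v u w j : (0 < j)%N -> v \in A -> nbrs A v = [set u; w] ->
  prob A j = phi j * prob (A :\ v) j - prob_sep (A :\ v) u w j / j%:R.
Proof.
move=> j0 vA nu; have := congr1 (fun m => m%:R : rat) (nproper_deg2 j vA nu).
have jn : j%:R != 0 :> rat by rewrite pnatr_eq0; lia.
rewrite /= !natrD !natrM /prob /prob_sep /phi => /(solve_mul jn) ->; ring.
Qed.

Lemma prob_sep_deg1 A x y z j : (0 < j)%N ->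
  y \in A -> nbrs A y = [set z] -> x != y ->
  prob_sep A x y j = phi j * prob (A :\ y) j - prob_sep (A :\ y) x z j / j%:R.
Proof.
move=> j0 yA nz xy; have := congr1 (fun m => m%:R : rat) (nproper_sep_deg1 j yA nz xy).
have jn : j%:R != 0 :> rat by rewrite pnatr_eq0; lia.
rewrite /= !natrD !natrM /prob /prob_sep /phi => /(solve_mul jn) ->; ring.
Qed.

Lemma prob_sep_refl A x j : prob_sep A x x j = 0.
Proof.
rewrite /prob_sep /nproper_sep eq_card0 ?mul0r // => f.
by rewrite !inE eqxx andbF.
Qed.

Definition two_regular A := {in A, forall v, deg_in A v = 2}.

(* Such an A is a path of k edges from x to y together with a 2-regular part A';
   the path is consumed from y, so that no walk needs to be constructed. *)
Lemma prob_peel_path A x y :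
  x \in A -> y \in A -> x != y -> deg_in A x = 1 -> deg_in A y = 1 ->
  {in A, forall v, v != x -> v != y -> deg_in A v = 2} ->
  exists k (A' : {set G}),
    [/\ (0 < k)%N, A' \subset A, two_regular A',
        deg_sum A = (deg_sum A' + 2 * k)%N &
        forall j, (0 < j)%N ->
          prob A j = phi j ^+ k * prob A' j /\
          prob_sep A x y j = psi k j * prob A' j].
Proof.
have [m] := ubnP #|A|; elim: m A y => // m IH A y Am xA yA xy dx dy dA.
have /cards1P[z nz] : #|nbrs A y| == 1 by rewrite -[X in X == _]/(deg_in A y) dy.
have adjy v : v \in A -> adj v y = (v == z).
  by move=> vA; rewrite -in_set1 -nz inE vA adj_sym.
have zA : z \in A by have := set11 z; rewrite -nz inE => /andP[].
have zy : z != y by have := notin_nbrs A y; rewrite nz inE eq_sym.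
have Ay : (#|A :\ y| < m)%N by move: Am; rewrite (cardsD1 y A) yA; lia.
(* If the neighbor of [y] is [x], the path is a single edge and both ends are removed; otherwise [z]
   is the new end of a shorter path. *)
have [zx|zx] := eqVneq z x.
  have xAy : x \in A :\ y by rewrite !inE xy.
  have d0 : deg_in (A :\ y) x = 0.
    by have := deg_inD1 x yA; rewrite dx adjy // zx eqxx; lia.
  exists 1, (A :\ y :\ x); split=> //.
  - by apply: subset_trans (subD1set _ _) (subD1set _ _).
  - move=> v; rewrite !inE => /and3P[vx vy vA].
    have := deg_inD1 v yA; rewrite (deg_inD1 v xAy) dA // adjy // zx (negbTE vx).
    suff -> : adj v x = false by lia.
    apply/negP => vx'; have : v \in nbrs (A :\ y) x.
      by rewrite !inE vy vA adj_sym.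
    by move/eqP: d0; rewrite cards_eq0 => /eqP ->; rewrite inE.
  - by rewrite (deg_sumD1 yA) (deg_sumD1 xAy) d0 dy; lia.
  - move=> j j0; rewrite (prob_deg1 j0 yA) // (prob_sep_deg1 j0 yA nz xy) zx.
    by rewrite prob_sep_refl (prob_deg0 _ xAy) // /= !mul0r !subr0.
have xz : x != z by rewrite eq_sym.
have dAy v : v \in A -> deg_in A v = ((v == z) + deg_in (A :\ y) v)%N.
  by move=> vA; rewrite (deg_inD1 v yA) adjy.
have [|||||k [A' [k0 sA rA eA pA]]] := IH (A :\ y) z Ay _ _ xz.
- by rewrite !inE xy.
- by rewrite !inE zy.
- by have := dAy x xA; rewrite (negbTE xz) dx.
- by have := dAy z zA; rewrite eqxx dA //; lia.
- move=> v /setD1P[vy vA] vx vz.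
  by have := dAy v vA; rewrite (negbTE vz) dA.
exists k.+1, A'; split=> //.
- by apply: subset_trans sA (subD1set _ _).
- by rewrite (deg_sumD1 yA) eA dy; lia.
move=> j j0; have [e1 e2] := pA j j0.
rewrite (prob_deg1 j0 yA) // (prob_sep_deg1 j0 yA nz xy) e1 e2 /= !exprS.
by split; ring.
Qed.

(** Deleting any [v] leaves its two neighbors as the only vertices of degree one, so
    [prob_peel_path] applies between them; putting [v] back closes the path into a cycle. *)
Lemma prob_peel_cycle A : A != set0 -> two_regular A ->
  exists k (A' : {set G}),
    [/\ (1 < k)%N, A' \proper A, two_regular A',
        deg_sum A = (deg_sum A' + 2 * k.+1)%N &
        forall j, (0 < j)%N -> prob A j = psi k j * prob A' j].
Proof.
case/set0Pn=> v vA rA.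
have /cards2P[u [w [uw nv]]] : #|nbrs A v| == 2 by rewrite -[X in X == _]/(deg_in A v) rA.
have adjv x : x \in A -> adj x v = (x == u) || (x == w).
  by move=> xA; rewrite -in_set2 -nv inE xA adj_sym.
have nbrAv x : x \in nbrs A v -> x \in A :\ v.
  by rewrite !inE => /andP[-> vx]; rewrite andbT; apply: contraTneq vx => ->; rewrite adj_irrefl.
have uA : u \in A :\ v by apply: nbrAv; rewrite nv !inE eqxx.
have wA : w \in A :\ v by apply: nbrAv; rewrite nv !inE eqxx orbT.
have dg x : x \in A :\ v -> deg_in (A :\ v) x = (2 - ((x == u) || (x == w)))%N.
  by case/setD1P=> _ xA; have := deg_inD1 x vA; rewrite adjv // rA //; lia.
have [|||k [A' [k0 sA rA' eA pA]]] := prob_peel_path uA wA uw.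
- by rewrite dg // eqxx.
- by rewrite dg // eqxx orbT.
- by move=> x xA xu xw; rewrite dg // (negbTE xu) (negbTE xw).
exists k.+1, A'; split=> //.
- by apply: sub_proper_trans sA (properD1 vA).
- by rewrite (deg_sumD1 vA) eA rA //; lia.
move=> j j0; have [e1 e2] := pA j j0.
by rewrite (prob_deg2 j0 vA nv) e1 e2 /= !exprS; ring.
Qed.

(** A vertex of degree at most one is removed as long as there is one; otherwise [A] is empty or
    2-regular, and a cycle is removed. The equation on [deg_sum] counts the edges. *)
Lemma prob_factor A : {in A, forall v, (deg_in A v <= 2)%N} ->
  exists b (ks : seq nat),
    [/\ all (leq 2) ks, deg_sum A = (2 * (b + \sum_(k <- ks) k.+1))%N &
        forall j, (0 < j)%N ->
          prob A j = phi j ^+ b * \prod_(k <- ks) psi k j].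
Proof.
have [m] := ubnP #|A|; elim: m A => // m IH A Am dA.
have peel v : v \in A -> (deg_in A v <= 1)%N -> exists b (ks : seq nat),
    [/\ all (leq 2) ks, deg_sum A = (2 * (b + \sum_(k <- ks) k.+1))%N &
        forall j, (0 < j)%N ->
          prob A j = phi j ^+ b * \prod_(k <- ks) psi k j].
  move=> vA dv; have [||b [ks [k2 e pA]]] := IH (A :\ v).
  - by move: Am; rewrite (cardsD1 v A) vA; lia.
  - by move=> x /setD1P[_ xA]; have := dA x xA; rewrite (deg_inD1 x vA); lia.
  exists (b + deg_in A v)%N, ks; split=> //.
    by rewrite (deg_sumD1 vA) e; lia.
  move=> j j0; case: (posnP (deg_in A v)) => d.
    by rewrite (prob_deg0 _ vA d) d addn0 pA.
  have d1 : deg_in A v = 1%N by lia.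
  by rewrite (prob_deg1 j0 vA d1) d1 addn1 exprS pA // mulrA.
case: (pickP [pred v in A | (deg_in A v <= 1)%N]) => [v /andP[]|hA]; first exact: peel.
have rA : two_regular A.
  by move=> v vA; have := dA v vA; have := hA v; rewrite /= vA /=; lia.
have [->|A0] := eqVneq A set0.
  exists 0%N, [::]; split=> //; first by rewrite /deg_sum big_set0 big_nil.
  by move=> j j0; rewrite prob0 // big_nil mulr1.
have [k [A' [k1 sA rA' eA pA]]] := prob_peel_cycle A0 rA.
have [||b [ks [k2 e pA']]] := IH A'.
- by apply: leq_trans (proper_card sA) _.
- by move=> v vA; rewrite rA'.
exists b, (k :: ks); split; first by rewrite /= k1.
  by rewrite big_cons eA e; lia.
by move=> j j0; rewrite pA // pA' // big_cons; ring.
Qed.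

End Induced.

(** * Monotonicity of the factors *)

Local Open Scope ring_scope.

(** The range starts at 2 because [weight] vanishes below. The value at 2 may be zero, as for odd
    cycles, so positivity is asked one step later. *)
Definition growing (f : nat -> rat) : Prop :=
  forall j, (2 <= j)%N -> [/\ 0 <= f j, f j <= f j.+1 & 0 < f j.+1].

(** Strictness starts at 3 because the ratio of the cycle of length four is 1/2 at both [j = 2] and
    [j = 3]. *)
Definition strictly_growing (f : nat -> rat) : Prop :=
  growing f /\ forall j, (3 <= j)%N -> f j < f j.+1.

Lemma growing_ext f g : (forall j, (2 <= j)%N -> f j = g j) ->
  growing f -> growing g.
Proof. by move=> e fg j j2; rewrite -!e //; [apply: fg | lia]. Qed.

Lemma strictly_growing_ext f g : (forall j, (2 <= j)%N -> f j = g j) ->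
  strictly_growing f -> strictly_growing g.
Proof.
move=> e [fg fs]; split; first exact: growing_ext e fg.
by move=> j j3; rewrite -!e //; [apply: fs | lia | lia].
Qed.

Lemma growingM f g : growing f -> growing g -> growing (fun j => f j * g j).
Proof.
move=> fg gg j j2; have [f0 f1 f2] := fg j j2; have [g0 g1 g2] := gg j j2.
by split; [rewrite mulr_ge0 | rewrite ler_pM | rewrite mulr_gt0].
Qed.

Lemma strictly_growingM f g :
  strictly_growing f -> growing g -> strictly_growing (fun j => f j * g j).
Proof.
move=> [fg fs] gg; split; first exact: growingM.
move=> j j3; have j2 : (2 <= j)%N by lia.
have [f0 f1 f2] := fg j j2; have [g0 g1 g2] := gg j j2.
by apply: le_lt_trans (_ : f j * g j.+1 < _); [rewrite ler_wpM2l | rewrite ltr_pM2r ?fs].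
Qed.

Lemma growing1 : growing (fun=> 1).
Proof. by move=> j _; split; rewrite ?ler01 ?lexx ?ltr01. Qed.

Lemma growingX f n : growing f -> growing (fun j => f j ^+ n).
Proof.
move=> fg; elim: n => [|n IH]; first exact: growing1.
by apply: growing_ext (growingM fg IH) => j _; rewrite exprS.
Qed.

Lemma strictly_growingX f n : strictly_growing f ->
  strictly_growing (fun j => f j ^+ n.+1).
Proof.
move=> fs; apply: strictly_growing_ext (strictly_growingM fs (growingX n fs.1)).
by move=> j _; rewrite exprS.
Qed.

Lemma growing_prod (I : Type) (r : seq I) (f : I -> nat -> rat) :
  (forall i, growing (f i)) -> growing (fun j => \prod_(i <- r) f i j).
Proof.
move=> fg; elim: r => [|i r IH].
  by apply: growing_ext growing1 => j _; rewrite big_nil.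
by apply: growing_ext (growingM (fg i) IH) => j _; rewrite big_cons.
Qed.

Lemma strictly_growing_shift f :
  (forall s, (1 <= s)%N -> [/\ 0 <= f s.+1, f s.+1 <= f s.+2 & 0 < f s.+2]) ->
  (forall s, (2 <= s)%N -> f s.+1 < f s.+2) -> strictly_growing f.
Proof. by move=> h hs; split; case=> [|s] // js; [apply: h | apply: hs]. Qed.

Lemma growing_le f i j : growing f -> (2 <= i <= j)%N -> f i <= f j.
Proof.
move=> fg /andP[i2 /subnKC <-]; elim: (j - i)%N => [|d IH]; first by rewrite addn0.
by rewrite addnS; have [|_ + _] := fg (i + d)%N; [lia | apply: le_trans].
Qed.

(** * Closed forms and growth of [phi] and [psi] *)

Lemma phiS s : phi s.+1 = s%:R / s.+1%:R.
Proof. by rewrite /phi -[s.+1%:R]natr1; field; rewrite natr1 pnatr_eq0. Qed.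

(** For [k] at least 2 the numerator is the chromatic polynomial of the cycle of length [k + 1], at
    [j = s + 1]. *)
Lemma psiE k s :
  psi k s.+1 = s%:R * (s%:R ^+ k - (-1) ^+ k) / s.+1%:R ^+ k.+1.
Proof.
have s0 : s%:R + 1 != 0 :> rat by rewrite natr1 pnatr_eq0.
elim: k => [|k IH]; first by rewrite /= !expr0 subrr mulr0 mul0r.
rewrite /= IH phiS -[s.+1%:R]natr1 expr_div_n !exprS.
by field; rewrite s0 expf_neq0.
Qed.

Lemma strictly_growing_phi : strictly_growing phi.
Proof.
have lt s : phi s.+1 < phi s.+2.
  by rewrite /phi ltrD2l ltrN2 ltf_pV2 ?ltr_nat // posrE ltr0n.
apply: strictly_growing_shift => [s s1|s _]; last exact: lt.
by split; rewrite ?(ltW (lt _)) // phiS ?divr_ge0 ?divr_gt0 ?ler0n ?ltr0n.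
Qed.

(* Ratio of [psi k] to the factor [phi ^+ 2] contributed by the path on three
   vertices, for odd k and for even k, at j = s + 1. *)
Definition odd_ratio (k s : nat) : rat :=
  (s%:R ^+ k + 1) / (s%:R * s.+1%:R ^+ k.-1).
Definition even_ratio (k s : nat) : rat :=
  (1 - s%:R ^- k) * phi s.+1 ^+ k.-1.

Lemma odd_step_increasing (k s : nat) : (0 < k)%N -> (0 < s)%N ->
  (s%:R ^+ k.+1 + 1) / ((s%:R ^+ k + 1) * s.+1%:R) <
  (s.+1%:R ^+ k.+1 + 1) / ((s.+1%:R ^+ k + 1) * s.+2%:R) :> rat.
Proof.
move=> k0 s0.
have s1 : 1 <= s%:R :> rat by rewrite ler1n.
rewrite -[s.+2%:R]natr1 -[s.+1%:R]natr1 !exprS; set x : rat := s%:R in s1 *.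
have a1 : 1 <= x ^+ k by apply: exprn_ege1.
have ab : x ^+ k < (x + 1) ^+ k by rewrite ltrXn2r -?lt0n //; lra.
set a := x ^+ k in a1 ab *; set b := (x + 1) ^+ k in ab *.
have p1 : 0 < (a + 1) * (x + 1) by apply: mulr_gt0; lra.
have p2 : 0 < (b + 1) * (x + 1 + 1) by apply: mulr_gt0; lra.
rewrite ltr_pdivrMr // mulrAC ltr_pdivlMr // -subr_gt0.
(* With [a = x ^+ k] and [b = (x + 1) ^+ k], the cross-multiplied difference is a nonnegative term
   plus a positive one, because [1 <= a < b]. *)
rewrite [ltRHS](_ : _ = (a - 1) * (b + 1) + x * (x + 1) * (b - a)); last by ring.
apply: ltr_wpDl; first by apply: mulr_ge0; lra.
by rewrite !mulr_gt0 //; lra.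
Qed.

Lemma odd_ratioS k s : (0 < k)%N -> (0 < s)%N ->
  odd_ratio k.+1 s =
  odd_ratio k s * ((s%:R ^+ k.+1 + 1) / ((s%:R ^+ k + 1) * s.+1%:R)).
Proof.
case: k => // k _ s0; rewrite /odd_ratio /= [s.+1%:R ^+ k.+1]exprS.
have x0 : 0 < s%:R :> rat by rewrite ltr0n.
have y0 : 0 < s.+1%:R :> rat by rewrite ltr0n.
have c0 : s%:R ^+ k.+1 + 1 != 0 :> rat by rewrite gt_eqF // addr_gt0 ?exprn_gt0.
by field; rewrite nat1r c0 expf_neq0 ?gt_eqF.
Qed.

Lemma odd_ratio_gt0 k s : (0 < s)%N -> 0 < odd_ratio k s.
Proof.
move=> s0; rewrite divr_gt0 // ?addr_gt0 ?mulr_gt0 ?exprn_gt0 ?ltr0n //.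
Qed.

(** Induction over exponents of either parity: the multiplier in [odd_ratioS] is strictly increasing
    in [s], so weak growth at one exponent gives strict growth at the next. Exponent 2 could not be
    the base: its values at [s = 1] and [s = 2] are 1 and 5/6. *)
Lemma odd_ratio_increasing k s : (0 < s)%N ->
  odd_ratio k.+3 s <= odd_ratio k.+3 s.+1 /\
  ((1 < s)%N -> odd_ratio k.+3 s < odd_ratio k.+3 s.+1).
Proof.
move=> s0; elim: k => [|k [IH _]].
  have s1 : 1 <= s%:R :> rat by rewrite ler1n.
  rewrite /odd_ratio /= -[s.+2%:R]natr1 -[s.+1%:R]natr1.
  have -> : (1 < s)%N = (1 < s%:R :> rat) by rewrite ltr1n.
  set x : rat := s%:R in s1 *.
  have p1 : 0 < x * (x + 1) ^+ 2 by rewrite mulr_gt0 ?exprn_gt0 //; lra.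
  have p2 : 0 < (x + 1) * (x + 1 + 1) ^+ 2 by rewrite mulr_gt0 ?exprn_gt0 //; lra.
  rewrite ler_pdivrMr // mulrAC ler_pdivlMr // ltr_pdivrMr // [X in _ -> _ < X]mulrAC ltr_pdivlMr //.
  rewrite -subr_ge0 -[X in _ -> is_true X]subr_gt0.
  (* The factor [x - 1] accounts for the tie at [s = 1]. *)
  rewrite (_ : _ - _ = 2 * (x - 1) * (x + 1) ^+ 2 * (x + 2)); last by ring.
  have q : 0 < (x + 1) ^+ 2 * (x + 2) by rewrite mulr_gt0 ?exprn_gt0 //; lra.
  rewrite -mulrA pmulr_lge0 // [X in _ -> is_true X]pmulr_lgt0 //; split; first lra.
  by lra.
have lt := odd_step_increasing (isT : (0 < k.+3)%N) s0.
have g0 : 0 < (s%:R ^+ k.+4 + 1) / ((s%:R ^+ k.+3 + 1) * s.+1%:R) :> rat.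
  by rewrite divr_gt0 ?mulr_gt0 ?addr_gt0 ?exprn_gt0 ?ltr0n.
suff lt' : odd_ratio k.+4 s < odd_ratio k.+4 s.+1 by split=> // ; apply: ltW.
rewrite [ltLHS]odd_ratioS // [ltRHS]odd_ratioS //; apply: le_lt_trans (ler_wpM2r (ltW g0) IH) _.
by rewrite ltr_pM2l ?odd_ratio_gt0.
Qed.

Lemma psi_odd k s : odd k -> (0 < s)%N -> (0 < k)%N ->
  psi k s.+1 = odd_ratio k s * phi s.+1 ^+ 2.
Proof.
case: k => // k ko s0 _; rewrite psiE phiS /odd_ratio /= -signr_odd ko expr1 opprK.
rewrite expr_div_n !exprS expr0.
have x0 : s%:R != 0 :> rat by rewrite pnatr_eq0; lia.
have y0 : s.+1%:R != 0 :> rat by rewrite pnatr_eq0.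
by field; rewrite ?nat1r x0 y0 ?expf_neq0.
Qed.

Lemma psi_even k s : ~~ odd k -> (0 < s)%N -> (0 < k)%N ->
  psi k s.+1 = even_ratio k s * phi s.+1 ^+ 2.
Proof.
case: k => // k /negbTE ko s0 _; rewrite psiE phiS /even_ratio /= -signr_odd ko expr0.
rewrite phiS !expr_div_n !exprS expr0.
have x0 : s%:R != 0 :> rat by rewrite pnatr_eq0; lia.
have y0 : s.+1%:R != 0 :> rat by rewrite pnatr_eq0.
by field; rewrite ?nat1r x0 y0 ?expf_neq0.
Qed.

Lemma psi_ratio k : (2 <= k)%N -> exists2 g, strictly_growing g &
  forall j, (0 < j)%N -> psi k j = g j * phi j ^+ 2.
Proof.
move=> k2.
(* At [j = 1] both [psi k] and [phi] vanish, so the identity holds there whatever value [g]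
   takes. *)
have psi1 : psi k 1 = 0 by rewrite psiE mul0r mul0r.
have phi1 : phi 1 = 0 by rewrite phiS mul0r.
case: (boolP (odd k)) => ko.
  exists (fun j => odd_ratio k j.-1); last first.
    move=> [|[|s]] // _; first by rewrite psi1 phi1 expr0n mulr0.
    by rewrite psi_odd //; lia.
  have [l ->] : exists l, k = l.+3 by exists (k - 3)%N; move: ko k2; lia.
  apply: strictly_growing_shift => /= s s1; last first.
    by have [|_] := odd_ratio_increasing l (_ : (0 < s)%N); [lia | apply].
  have [le _] := odd_ratio_increasing l s1.
  by split=> //; rewrite ?(ltW (odd_ratio_gt0 _ s1)) ?odd_ratio_gt0.
exists (fun j => (1 - j.-1%:R ^- k) * phi j ^+ k.-1); last first.
  move=> [|[|s]] // _; first by rewrite psi1 phi1 expr0n mulr0.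
  by rewrite psi_even //; lia.
have k1 : k.-1 = k.-2.+1 by lia.
rewrite k1; apply: strictly_growing_ext (strictly_growingM
  (strictly_growingX k.-2 strictly_growing_phi) (_ : growing (fun j => 1 - j.-1%:R ^- k))).
  by move=> j _; rewrite mulrC.
case=> [|[|s]] // _ /=.
have lt m : (0 < m)%N -> m.+1%:R ^- k < m%:R ^- k :> rat.
  move=> m0; rewrite ltf_pV2 ?posrE ?exprn_gt0 ?ltr0n // ltrXn2r ?ler0n ?ltr_nat //.
  by lia.
have l1 m : (0 < m)%N -> m%:R ^- k <= 1 :> rat.
  by move=> m0; rewrite invf_le1 ?exprn_gt0 ?ltr0n // exprn_ege1 ?ler1n.
have := lt s.+1 isT; have := l1 s.+1 isT.
by move: (_ ^- k) (_ ^- k) => u v *; split; lra.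
Qed.

Lemma growing_psi k : (2 <= k)%N -> growing (psi k).
Proof.
move=> k2; have [g gs e] := psi_ratio k2.
apply: growing_ext (growingM gs.1 (growingX 2 strictly_growing_phi.1)).
by move=> j j2; rewrite e //; lia.
Qed.

(** Without cycles the quotient is a power of [phi], constant only for [b = 2]. With a cycle, its
    own ratio to [phi ^+ 2] is strictly growing, and the other growing factors preserve this. *)
Lemma psi_prod_ratio b ks : all (leq 2) ks ->
  (2 <= b + \sum_(k <- ks) k.+1)%N ->
  exists2 g, growing g /\
    (b + \sum_(k <- ks) k.+1 != 2 -> strictly_growing g)%N &
    forall j, (0 < j)%N ->
      phi j ^+ b * \prod_(k <- ks) psi k j = g j * phi j ^+ 2.
Proof.
case: ks => [_|k ks /andP[k2 /allP ks2] _].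
  rewrite big_nil addn0 => b2; exists (fun j => phi j ^+ (b - 2)).
    split=> [|bn]; first exact: growingX strictly_growing_phi.1.
    rewrite (_ : (b - 2 = (b - 3).+1)%N); first exact: strictly_growingX strictly_growing_phi.
    by lia.
  by move=> j _; rewrite big_nil mulr1 -exprD subnK.
have [g gs e] := psi_ratio k2.
have sg : strictly_growing (fun j => g j * (phi j ^+ b * \prod_(l <- ks) psi l j)).
  apply: strictly_growingM => //; apply: growingM; first exact: growingX strictly_growing_phi.1.
  (* [growing_prod] asks for growth at every index, so the index is raised to [maxn l 2], which
     equals [l] on [ks]. *)
  apply: growing_ext (growing_prod ks (_ : forall l, growing (psi (maxn l 2)))).
    by move=> j _; apply: eq_big_seq => l /ks2 l2; rewrite (maxn_idPl l2).
  by move=> l; apply: growing_psi; rewrite leq_maxr.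
exists (fun j => g j * (phi j ^+ b * \prod_(l <- ks) psi l j)).
  by split=> // ; case: sg.
by move=> j j0; rewrite big_cons e //; ring.
Qed.

(** * Comparison of the averages *)

Lemma is_coloring_proper_on (G : sgraph) j (f : {ffun G -> 'I_j}) :
  is_coloring f = proper_on [set: G] f.
Proof. by apply/is_coloringP/proper_onP => h x y => [_ _|]; apply: h. Qed.

Lemma ncolorings_prob (G : sgraph) j : (0 < #|G|)%N ->
  (ncolorings G j)%:R = prob [set: G] j * (j ^ #|G|)%:R.
Proof.
move=> G0; have -> : ncolorings G j = nproper [set: G] j.
  by apply: eq_card => f; rewrite !inE is_coloring_proper_on.
have [->|j0] := posnP j.
  rewrite exp0n // mulr0 /nproper eq_card0 // => f.
  by case/card_gt0P: G0 => x _; case: (f x).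
by rewrite divfK // pnatr_eq0 expn_eq0; lia.
Qed.

Lemma deg_sumE (G : sgraph) : deg_sum [set: G] = (\sum_(x : G) \sum_(y : G) adj x y)%N.
Proof.
rewrite /deg_sum; apply: eq_big => [x|x _]; first by rewrite inE.
rewrite /deg_in -sum1_card [LHS]big_mkcond /=; apply: eq_bigr => y _.
by rewrite !inE; case: adj.
Qed.

Lemma deg_sum_isomorphic (G H : sgraph) :
  isomorphic G H -> deg_sum [set: G] = deg_sum [set: H].
Proof.
case=> f fb fa; rewrite !deg_sumE [RHS](reindex f) /=; last exact: onW_bij.
apply: eq_bigr => x _; rewrite [RHS](reindex f) /=; last exact: onW_bij.
by apply: eq_bigr => y _; rewrite fa.
Qed.

Lemma deg_in_deg_sum (G : sgraph) (x : G) :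
  (2 * deg_in [set: G] x <= deg_sum [set: G])%N.
Proof. by rewrite (deg_sumD1 (in_setT x)) leq_addl. Qed.

Section Weight.
Variable n : nat.

(* Number of proper j-colorings of the path on three vertices plus n - 3
   isolated vertices. *)
Definition weight (j : nat) : rat := phi j ^+ 2 * (j ^ n)%:R.

Lemma weight_small j : (0 < n)%N -> (j <= 1)%N -> weight j = 0.
Proof.
move=> n0; case: j => [|[|]] // _; first by rewrite /weight exp0n // mulr0.
by rewrite /weight phiS expr2 !mul0r.
Qed.

Lemma weight_gt0 j : (1 < j)%N -> 0 < weight j.
Proof.
case: j => // j j0; rewrite /weight phiS mulr_gt0 ?exprn_gt0 ?divr_gt0 ?ltr0n //.
by rewrite expn_gt0.
Qed.

Lemma weight_ge0 j : (0 < n)%N -> 0 <= weight j.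
Proof.
move=> n0; case: (leqP j 1) => j1; first by rewrite weight_small.
by rewrite ltW // weight_gt0.
Qed.

End Weight.

Lemma ncolorings_ratio (G : sgraph) : (0 < #|G|)%N ->
  (forall x : G, deg_in [set: G] x <= 2)%N -> (4 <= deg_sum [set: G])%N ->
  exists2 g, growing g /\ (deg_sum [set: G] != 4 -> strictly_growing g)%N &
    forall j, (ncolorings G j)%:R = g j * weight #|G| j.
Proof.
move=> G0 dG e4.
have [|b [ks [ks2 eG pG]]] := @prob_factor G [set: G]; first by move=> x _.
have [|g [gg gs] e] := psi_prod_ratio (b := b) ks2; first by lia.
exists g; first by split=> // ne; apply: gs; lia.
move=> j; rewrite ncolorings_prob //; have [->|j0] := posnP j.
  by rewrite weight_small // exp0n // !mulr0.
by rewrite pG // e // -mulrA.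
Qed.

(** A cycle needs at least three edges, so two edges can only give leaf factors, with [b = 2]. *)
Lemma ncolorings_weight (G : sgraph) : (0 < #|G|)%N -> deg_sum [set: G] = 4%N ->
  forall j, (ncolorings G j)%:R = weight #|G| j.
Proof.
move=> G0 e4 j; rewrite ncolorings_prob //.
have [->|j0] := posnP j; first by rewrite weight_small // exp0n // mulr0.
have [x _|b [ks [ks2 eG pG]]] := @prob_factor G [set: G].
  by have := deg_in_deg_sum x; lia.
rewrite pG //; case: ks ks2 eG {pG} => [_|k ks /andP[k2 _]].
  by rewrite !big_nil e4 addn0 mulr1 => eb; rewrite (_ : b = 2%N) //; lia.
by rewrite big_cons; lia.
Qed.

(** When [x] and [g] are ordered alike and the weights [q] are nonnegative, every term on the right
    is nonnegative. *)
Lemma chebyshev_sum (I : finType) (x q g : I -> rat) :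
  2 * ((\sum_i x i * (g i * q i)) * (\sum_i q i)
       - (\sum_i x i * q i) * (\sum_i g i * q i)) =
  \sum_i \sum_k (x i - x k) * (g i - g k) * (q i * q k).
Proof.
transitivity (\sum_i \sum_k ((x i * (g i * q i)) * q k - (x i * q i) * (g k * q k)
    - (g i * q i) * (x k * q k) + q i * (x k * (g k * q k)))); last first.
  by apply: eq_bigr => i _; apply: eq_bigr => k _; ring.
under [RHS]eq_bigr => i _ do rewrite big_split /= !sumrB /=.
rewrite [RHS]big_split !sumrB /= -!big_distrlr /=.
by ring.
Qed.

Lemma nfix1 N : nfix (1 : 'S_N)%g = N.
Proof. by rewrite -[RHS]card_ord; apply: eq_card => i; rewrite !inE perm1 eqxx. Qed.

Lemma nfix_tperm N (x y : 'I_N) : x != y -> nfix (tperm x y) = (N - 2)%N.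
Proof.
move=> xy; rewrite -[N in RHS]card_ord -(cardsC [set x; y]) cards2 xy addKn.
apply: eq_card => i; rewrite !inE negb_or; case: tpermP => [->|->|/eqP-> /eqP->].
- by rewrite eqxx eq_sym (negbTE xy).
- by rewrite eqxx (negbTE xy) andbF.
by rewrite eqxx.
Qed.

Section Comparison.
Variables (n N : nat) (g : nat -> rat).
Hypotheses (n0 : (0 < n)%N) (N4 : (4 <= N)%N) (gg : growing g).

Let term (s t : 'S_N) : rat :=
  ((nfix s)%:R - (nfix t)%:R) * (g (nfix s) - g (nfix t))
  * (weight n (nfix s) * weight n (nfix t)).

Let gap : rat :=
  (\sum_(s : 'S_N) (nfix s)%:R * (g (nfix s) * weight n (nfix s)))
  * (\sum_(s : 'S_N) weight n (nfix s))
  - (\sum_(s : 'S_N) (nfix s)%:R * weight n (nfix s))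
  * (\sum_(s : 'S_N) g (nfix s) * weight n (nfix s)).

(** With at most one fixed point the weight is zero; from two on, [g] is monotone and both
    differences have the same sign. *)
Let term_ge0 s t : 0 <= term s t.
Proof.
rewrite /term; case: (leqP (nfix s) 1) => s2.
  by rewrite (weight_small n0 s2) mul0r mulr0.
case: (leqP (nfix t) 1) => t2; first by rewrite (weight_small n0 t2) !mulr0.
rewrite mulr_ge0 //; last by rewrite mulr_ge0 ?weight_ge0.
have [st|ts] := leqP (nfix s) (nfix t).
  have h := growing_le gg (introT andP (conj s2 st)).
  by rewrite mulr_le0 // subr_le0 ?ler_nat.
have h := growing_le gg (introT andP (conj t2 (ltnW ts))).
by rewrite mulr_ge0 // subr_ge0 ?ler_nat // ltnW.
Qed.

Lemma weight_sum_gt0 : 0 < \sum_(s : 'S_N) g (nfix s) * weight n (nfix s).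
Proof.
rewrite (bigD1 1%g) //= ltr_wpDr //.
  apply: sumr_ge0 => s _; case: (leqP (nfix s) 1) => s2.
    by rewrite weight_small ?mulr0.
  by rewrite mulr_ge0 ?weight_ge0 //; have [] := gg s2.
rewrite nfix1 mulr_gt0 ?weight_gt0 //; last by lia.
by have := gg (_ : 2 <= N.-1)%N; rewrite prednK; [case=> //|]; lia.
Qed.

Lemma gap_ge0 : 0 <= gap.
Proof.
rewrite -(pmulr_rge0 _ (_ : 0 < 2)) // chebyshev_sum.
by apply: sumr_ge0 => s _; apply: sumr_ge0 => t _; apply: term_ge0.
Qed.

(** One pair gives a positive term: the identity and a transposition, with [N] and [N - 2] fixed
    points. *)
Lemma gap_gt0 : strictly_growing g -> 0 < gap.
Proof.
case=> _ gs; rewrite -(pmulr_rgt0 _ (_ : 0 < 2)) // chebyshev_sum.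
have N0 : (0 < N)%N by lia.
have N1 : (1 < N)%N by lia.
pose t := tperm (Ordinal N0) (Ordinal N1).
have ft : nfix t = (N - 2)%N by apply: nfix_tperm.
rewrite (bigD1 1%g) //= ltr_wpDr //.
  by apply: sumr_ge0 => s _; apply: sumr_ge0 => t' _; apply: term_ge0.
rewrite (bigD1 t) //= ltr_wpDr //.
  by apply: sumr_ge0 => t' _; apply: term_ge0.
rewrite nfix1 ft; apply: mulr_gt0; last by apply: mulr_gt0; apply: weight_gt0; lia.
apply: mulr_gt0; rewrite subr_gt0; first by rewrite ltr_nat; lia.
(* The strict step is from [N - 1], which is at least 3, whereas [N - 2] may be 2. *)
apply: le_lt_trans (_ : g N.-1 < _); first by apply: growing_le gg _; lia.
by have := gs N.-1; rewrite prednK //; apply; lia.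
Qed.

End Comparison.

Section ColAverage.
Variables (n : nat) (G : sgraph) (g : nat -> rat).
Hypotheses (n0 : (0 < n)%N) (Gn : #|G| = n)
  (pG : forall j, (ncolorings G j)%:R = g j * weight n j).

Lemma colB_sum :
  \sum_(s : 'S_n.+1) g (nfix s) * weight n (nfix s) = (n.+1)`!%:R * (colB G)%:R.
Proof.
rewrite -natrM -sum_ncolorings_nfix ?Gn // natr_sum.
by apply: eq_bigr => s _; rewrite pG.
Qed.

Lemma colT_sum :
  \sum_(s : 'S_n.+1) (nfix s)%:R * (g (nfix s) * weight n (nfix s))
  = (n.+1)`!%:R * ((colT G)%:R + (colB G)%:R).
Proof.
rewrite -natrD -natrM -sum_mul_ncolorings_nfix ?Gn // natr_sum.
by apply: eq_bigr => s _; rewrite natrM pG.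
Qed.

Lemma colB_gt0 : (3 <= n)%N -> growing g -> 0 < (colB G)%:R :> rat.
Proof.
move=> n3 gg; have := @weight_sum_gt0 n n.+1 g n0 n3 gg.
by rewrite colB_sum pmulr_rgt0 // ltr0n fact_gt0.
Qed.

End ColAverage.

Lemma colA_compare (n : nat) (G H : sgraph) (g : nat -> rat) :
  (3 <= n)%N -> #|G| = n -> #|H| = n -> growing g ->
  (forall j, (ncolorings G j)%:R = g j * weight n j) ->
  (forall j, (ncolorings H j)%:R = weight n j) ->
  colA H <= colA G /\ (strictly_growing g -> colA H < colA G).
Proof.
move=> n3 Gn Hn gg pG pH; have n0 : (0 < n)%N by lia.
have pH' j : (ncolorings H j)%:R = (fun=> 1) j * weight n j by rewrite mul1r pH.
have BG := colB_gt0 n0 Gn pG n3 gg.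
have BH := colB_gt0 n0 Hn pH' n3 growing1.
have := colT_sum n0 Hn pH'; have := colB_sum n0 Hn pH'.
under eq_bigr do rewrite mul1r; move=> sB.
under eq_bigr do rewrite mul1r; move=> sT.
have M0 : 0 < (n.+1)`!%:R :> rat by rewrite ltr0n fact_gt0.
have ge := @gap_ge0 n n.+1 g n0 gg.
have gt := @gap_gt0 n n.+1 g n0 n3 gg.
move: ge gt; rewrite sB sT (colT_sum n0 Gn pG) (colB_sum n0 Gn pG).
set M := (n.+1)`!%:R in M0 *; set tG := (colT G)%:R; set bG := (colB G)%:R in BG *.
set tH := (colT H)%:R; set bH := (colB H)%:R in BH *.
(* The shifts of [colT] by [colB] cancel, leaving the cross-multiplied comparison of the
   averages. *)
rewrite (_ : _ - _ = M ^+ 2 * (tG * bH - tH * bG)); last by ring.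
have MM : 0 < M ^+ 2 by rewrite exprn_gt0.
rewrite pmulr_rge0 // pmulr_rgt0 // subr_ge0 subr_gt0 /colA -/tG -/bG -/tH -/bH.
move=> ge gt; split=> [|/gt]; first by rewrite ler_pdivrMr // mulrAC ler_pdivlMr.
by rewrite ltr_pdivrMr // mulrAC ltr_pdivlMr.
Qed.

(** Averaging over permutations recovers [colB] and [colT] from the numbers of colorings alone. *)
Lemma colA_ncolorings (n : nat) (G H : sgraph) :
  (0 < n)%N -> #|G| = n -> #|H| = n -> ncolorings G =1 ncolorings H ->
  colA G = colA H.
Proof.
move=> n0 Gn Hn e.
have M0 : ((n.+1)`! > 0)%N := fact_gt0 _.
have eB : colB G = colB H.
  apply/eqP; rewrite -(eqn_pmul2l M0) -!sum_ncolorings_nfix ?Gn ?Hn //.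
  by apply/eqP/eq_bigr => s _; rewrite e.
have eT : (colT G + colB G = colT H + colB H)%N.
  apply/eqP; rewrite -(eqn_pmul2l M0) -!sum_mul_ncolorings_nfix ?Gn ?Hn //.
  by apply/eqP/eq_bigr => s _; rewrite e.
by rewrite /colA; congr (_%:R / _%:R); lia.
Qed.

(** * The extremal graph *)

Definition star_plus (m : nat) : sgraph := gunion (biclique 1 2) (edgeless m).

Lemma card_star_plus m : #|star_plus m| = (m + 3)%N.
Proof. by rewrite !card_sum !card_ord addnC. Qed.

Lemma deg_sum_star_plus m : deg_sum [set: star_plus m] = 4%N.
Proof.
rewrite deg_sumE !big_sumType /= !big_ord_recl !big_ord0 /=.
rewrite !big_sumType /= !big_ord_recl !big_ord0 /= !big1 // => i _.
by rewrite big_sumType /= !big1 // => j _; rewrite big1.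
Qed.

(** The graph has two edges and both meet [v], so the center goes to [v], the leaves to its
    neighbors, and the isolated vertices enumerate the rest. *)
Lemma star_plus_isomorphic (G : sgraph) n (v : G) : #|G| = n ->
  deg_in [set: G] v = 2%N -> deg_sum [set: G] = 4%N ->
  isomorphic G (star_plus (n - 3)).
Proof.
move=> Gn dv e4.
have /cards2P[u [w [uw nv]]] : #|nbrs [set: G] v| == 2%N by rewrite -[X in X == _]/(deg_in _ v) dv.
have adjv x : adj v x = (x == u) || (x == w).
  by rewrite -in_set2 -nv !inE.
have vu : v != u by have := adjv u; rewrite eqxx; apply: contraTneq => <-; rewrite adj_irrefl.
have vw : v != w by have := adjv w; rewrite eqxx orbT; apply: contraTneq => <-; rewrite adj_irrefl.
have adj0 x y : x != v -> y != v -> adj x y = false.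
  move=> xv yv; have := deg_sumD1 (in_setT v); rewrite e4 dv => /eqP.
  rewrite -[X in X == _]add0n eqn_add2r eq_sym sum_nat_eq0 => /forall_inP/(_ x).
  rewrite !inE xv => /(_ isT); rewrite cards_eq0 => /eqP/setP/(_ y).
  by rewrite !inE yv.
pose R := ~: [set v; u; w].
have cR : (n - 3)%N = #|R|.
  have := cardsC [set v; u; w]; rewrite Gn -/R setUC cardsU1 cards2 !inE.
  rewrite negb_or eq_sym vw eq_sym uw vu; lia.
pose h (x : star_plus (n - 3)) : G := match x with
  | inl (inl _) => v
  | inl (inr i) => if i == ord0 then u else w
  | inr i => enum_val (cast_ord cR i)
  end.
have hR i : [/\ h (inr i) != v, h (inr i) != u & h (inr i) != w].
  by have := enum_valP (cast_ord cR i); rewrite !inE !negb_or => /andP[/andP[-> ->] ->].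
have h0 (i : 'I_2) : i != ord0 -> i = lift ord0 ord0.
  by case: i => [[|[]]] // ? _; apply: val_inj.
have hinj : injective h.
  move=> [[i|i]|i] [[k|k]|k] //=; rewrite ?ord1 //.
  - by case: ifP => _ /eqP; rewrite ?(negbTE vu) ?(negbTE vw).
  - by move/esym/eqP; case: (hR k) => /negbTE->.
  - by case: ifP => _ /esym/eqP; rewrite ?(negbTE vu) ?(negbTE vw).
  - case: eqVneq => [->|/h0 ->]; case: eqVneq => [->|/h0 ->] // /eqP.
      by rewrite (negbTE uw).
    by rewrite eq_sym (negbTE uw).
  - by case: (hR k) => _ /negbTE hu /negbTE hw; case: ifP => _ /esym/eqP; rewrite ?hu ?hw.
  - by move/eqP; case: (hR i) => /negbTE->.
  - by case: (hR i) => _ /negbTE hu /negbTE hw; case: ifP => _ /eqP; rewrite ?hu ?hw.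
  - by move/enum_val_inj/cast_ord_inj ->.
have n3 : (3 <= n)%N.
  rewrite -Gn; have := max_card (mem [set v; u; w]).
  by rewrite setUC cardsU1 cards2 !inE negb_or [w == v]eq_sym vw [w == u]eq_sym uw vu.
have hadj x y : adj (h x) (h y) = adj x y.
  have hv i : (h (inl (inr i)) == u) || (h (inl (inr i)) == w).
    by rewrite /h; case: ifP; rewrite eqxx ?orbT.
  have hn i : h (inl (inr i)) != v.
    by rewrite /h; case: ifP => _; rewrite eq_sym.
  case: x y => [[i|i]|i] [[k|k]|k]; rewrite [RHS]/=.
  - by rewrite adj_irrefl.
  - by rewrite [h (inl (inl _))]/= adjv hv.
  - by case: (hR k) => _ /negbTE hu /negbTE hw; rewrite [h (inl (inl _))]/= adjv hu hw.
  - by rewrite adj_sym [h (inl (inl _))]/= adjv hv.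
  - by rewrite adj0.
  - by case: (hR k) => hk _ _; rewrite adj0.
  - by case: (hR i) => _ /negbTE hu /negbTE hw; rewrite adj_sym [h (inl (inl _))]/= adjv hu hw.
  - by case: (hR i) => hk _ _; rewrite adj0.
  - by case: (hR i) => hi _ _; case: (hR k) => hk _ _; rewrite adj0.
have [|f hf fh] := inj_card_bij hinj; first by rewrite card_star_plus Gn subnK.
by exists f => [|x y]; [exists h | rewrite -hadj !fh].
Qed.

Local Close Scope ring_scope.

Theorem theorem27 (G : sgraph) (n : nat) (hn : #|G| = n)
    (hD : max_degree G = 2) :
  (colA (gunion (biclique 1 2) (edgeless (n - 3))) <= colA G)%R /\
  (colA G = colA (gunion (biclique 1 2) (edgeless (n - 3))) <->
   isomorphic G (gunion (biclique 1 2) (edgeless (n - 3)))).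
Proof.
rewrite -/(star_plus _).
have degE x : degree x = deg_in [set: G] x by apply: eq_card => y; rewrite !inE.
have dG x : (deg_in [set: G] x <= 2)%N by rewrite -degE -hD; apply: leq_bigmax.
have [v dv] : exists v : G, deg_in [set: G] v = 2%N.
  case: (pickP (mem G)) => [x0 _|n0]; last first.
    by move: hD; rewrite /max_degree big_pred0.
  have [|x hx] := @bigop.eq_bigmax G (@degree G).
    by apply/card_gt0P; exists x0.
  by exists x; rewrite -degE -hx.
have e4 : (4 <= deg_sum [set: G])%N by have := deg_in_deg_sum v; rewrite dv.
(* The vertex [v] and its two neighbors are three vertices, so [n - 3] is not truncated. *)
have n3 : (3 <= n)%N.
  rewrite -hn -cardsT (cardsD1 v) inE -dv ltnS; apply: subset_leq_card.
  apply/subsetP => x; rewrite !inE => vx; rewrite andbT.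
  by apply: contraTneq vx => ->; rewrite adj_irrefl.
have G0 : (0 < #|G|)%N by rewrite hn; lia.
have Hn : #|star_plus (n - 3)| = n by rewrite card_star_plus subnK.
have pH := ncolorings_weight (_ : 0 < #|star_plus (n - 3)|)%N (deg_sum_star_plus _).
rewrite Hn in pH; have {}pH := pH (ltnW (ltnW n3)).
(* With exactly two edges the coloring counts agree with those of the star. With more, the
   inequality is strict and an isomorphism is excluded by [deg_sum]. *)
have [eG|neG] := eqVneq (deg_sum [set: G]) 4%N.
  have eA : colA G = colA (star_plus (n - 3)).
    apply: (@colA_ncolorings n) => // [|j]; first by lia.
    apply/eqP; rewrite -(eqr_nat rat) pH -hn ncolorings_weight //.
  by rewrite eA; split=> //; split=> // _; apply: star_plus_isomorphic dv eG.
have [g [gg gs] pG] := ncolorings_ratio G0 dG e4.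
rewrite hn in pG.
have [_ /(_ (gs neG)) lt] := colA_compare n3 hn Hn gg pG pH.
split; first exact: ltW.
split=> [e|/deg_sum_isomorphic e]; first by rewrite e ltxx in lt.
by rewrite e deg_sum_star_plus eqxx in neG.
Qed.
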